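(* (Daehee constant) Let $q\in\mathbb{C}$ with $|q|<1$. Then $$e_q=\lim_{x\to\infty}\left(1\oplus_q\frac{1}{[x]_q}\right)^x .$$
   Context: Notation: $[x]_q=\frac{1-q^x}{1-q}$, and for positive integers $k$, $[k]_q!=[k]_q[k-1]_q\cdots[1]_q$, with $[0]_q!=1$. The constant $e_q$ is $e_q=\sum_{k=0}^{\infty}\frac{1}{[k]_q!}$. The $q$-binomial coefficient is $\binom{x}{k}_q=\frac{[x]_q[x-1]_q\cdots[x-k+1]_q}{[k]_q!}$. The $q$-addition $\oplus_q$ has meaning through its powers: for nonnegative integers $n$, $(a\oplus_q b)^n=\sum_{k=0}^n\binom{n}{k}_q a^k b^{n-k}$; for the variable exponent $x$ the expression in the claim is read as $$\left(1\oplus_q\frac{1}{[x]_q}\right)^x=\sum_{k=0}^{\infty}\binom{x}{k}_q\left(\frac{1}{[x]_q}\right)^k .$$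
   Formalization: The series for e_q is assumed to converge (it diverges when |1-q| ≥ 1, e.g. q = -1/2), and the limit is over those real x where the series for (1 ⊕_q 1/[x]_q)^x converges; for non-integer x > 0 it diverges, so in effect x runs through the positive integers. *)

(* Defs.v *)
(* Stdlib real numbers with Coquelicot. *)
From Stdlib Require Import Reals Lra.
From Coquelicot Require Import Coquelicot.
Open Scope R_scope.

(* Principal argument, in (-PI, PI]; meaningful for q <> 0 only. *)
Definition Carg (q : C) : R :=
  if Rle_dec 0 (Im q) then acos (Re q / Cmod q) else - acos (Re q / Cmod q).

(* Principal branch of q^x for real x.  For q = 0 the convention is 0^0 = 1 and
   0^x = 0 for x <> 0. *)
Definition qpow (q : C) (x : R) : C :=
  if Req_EM_T (Cmod q) 0 then (if Req_EM_T x 0 then RtoC 1 else RtoC 0)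
  else (RtoC (Rpower (Cmod q) x) * (cos (x * Carg q), sin (x * Carg q)))%C.

Definition qnum (q : C) (x : R) : C := ((1 - qpow q x) / (1 - q))%C.

Fixpoint qfact (q : C) (k : nat) : C :=
  match k with
  | O => RtoC 1
  | S j => (qnum q (INR (S j)) * qfact q j)%C
  end.

(* [x]_q [x-1]_q ... [x-k+1]_q *)
Fixpoint qfalling (q : C) (x : R) (k : nat) : C :=
  match k with
  | O => RtoC 1
  | S j => (qfalling q x j * qnum q (x - INR j))%C
  end.

Definition qbinom (q : C) (x : R) (k : nat) : C :=
  (qfalling q x k / qfact q k)%C.

(* Infinite series need not converge, so their values are given by relations:
   [is_e_const q e] says that the series defining e_q converges, with sum e. *)
Definition is_e_const (q e : C) : Prop :=
  is_series (fun k : nat => (1 / qfact q k)%C) e.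

(* s is the value of (1 (+)_q b)^x. *)
Definition is_qadd1_pow (q b : C) (x : R) (s : C) : Prop :=
  is_series (fun k : nat => (qbinom q x k * b ^ k)%C) s.

(* Limit at +oo of a single-valued partial function, given by its graph f:
   f is defined at arbitrarily large reals, and f x tends to l as x tends to +oo
   within the domain of f.  For 0 < |q| < 1 the series of [is_qadd1_pow] with
   b = 1/[x]_q and x > 0 diverges unless x is an integer, because [x-k+1]_q then
   grows like |q|^(-k); hence the need for a domain. *)
Definition is_partial_lim_pinfty (f : R -> C -> Prop) (l : C) : Prop :=
  (forall M : R, exists (x : R) (s : C), M < x /\ f x s) /\
  filterlimi f (within (fun x : R => exists s : C, f x s) (Rbar_locally p_infty))
    (locally l).

(* On integers the principal branch is the ordinary power. *)
Lemma qpow_INR (q : C) (n : nat) : qpow q (INR n) = (q ^ n)%C.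
Proof.
unfold qpow; destruct (Req_EM_T (Cmod q) 0) as [h|h].
- apply Cmod_eq_0 in h; subst q.
  destruct n as [|n].
  + destruct (Req_EM_T (INR 0) 0) as [_|k]; [reflexivity | now elim k].
  + destruct (Req_EM_T (INR (S n)) 0) as [k|_].
    * now apply (not_0_INR (S n)) in k.
    * rewrite Cpow_S, Cmult_0_l; reflexivity.
- assert (hp : 0 < Cmod q) by (destruct (Cmod_ge_0 q) as [k|k]; [exact k | now elim h]).
  assert (hm : Re q * Re q + Im q * Im q = Cmod q * Cmod q).
  { unfold Cmod; rewrite sqrt_sqrt; unfold Re, Im; simpl; [ring|].
    assert (u := Rle_0_sqr (fst q)); assert (v := Rle_0_sqr (snd q)).
    unfold Rsqr in u, v; lra. }
  assert (hb : -1 <= Re q / Cmod q <= 1).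
  { assert (hR : - Cmod q <= Re q <= Cmod q).
    { assert (v := Rle_0_sqr (Im q)); unfold Rsqr in v.
      split; [apply Rsqr_neg_pos_le_0 | apply Rsqr_incr_0_var]; unfold Rsqr; lra. }
    split; [apply Rle_div_r | apply Rle_div_l]; lra. }
  assert (hs : sqrt (1 - Rsqr (Re q / Cmod q)) = Rabs (Im q) / Cmod q).
  { replace (1 - Rsqr (Re q / Cmod q)) with (Rsqr (Im q / Cmod q)).
    - rewrite sqrt_Rsqr_abs; unfold Rdiv; rewrite Rabs_mult.
      now rewrite Rabs_inv, (Rabs_pos_eq (Cmod q)) by lra.
    - unfold Rsqr; apply (Rmult_eq_reg_r (Cmod q * Cmod q)); [|nra].
      field_simplify; [|lra..]; nra. }
  assert (hc : Cmod q * cos (Carg q) = Re q /\ Cmod q * sin (Carg q) = Im q).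
  { unfold Carg; destruct (Rle_dec 0 (Im q)) as [g|g];
      rewrite ?cos_neg, ?sin_neg, cos_acos, sin_acos, hs by exact hb.
    - rewrite Rabs_pos_eq by exact g; split; field; lra.
    - rewrite Rabs_left by lra; split; field; lra. }
  rewrite Rpower_pow by exact hp.
  induction n as [|n IH].
  + rewrite Rmult_0_l, cos_0, sin_0; simpl.
    apply injective_projections; simpl; ring.
  + rewrite Cpow_S, <- IH, S_INR, Rmult_plus_distr_r, Rmult_1_l, cos_plus, sin_plus.
    destruct hc as [h1 h2]; destruct q as [a b]; unfold Re, Im in h1, h2; simpl in h1, h2.
    set (r := Cmod (a, b)) in *; set (t := Carg (a, b)) in *.
    rewrite <- h1, <- h2; apply injective_projections; simpl; ring.
Qed.

(* Main.v *)
(* With r = |q| and d = |1 - q|, the terms of the series for e_q have modulus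
   d^k / prod_(j <= k) |1 - q^j|, and these products stay bounded, so the
   convergence of that series forces d < 1; in particular q <> 0.
   For x > 0 not an integer the ratio of consecutive terms of the series for
   (1 (+)_q 1/[x]_q)^x grows like r^(x-k), hence that series diverges and the
   domain of the limit contains, among positive reals, only integers.  For x = n the
   series is a finite sum whose k-th term tends to 1/[k]_q! and is dominated by
   C rho^k, with d < rho < 1, as soon as d <= rho (1 - r^n); Tannery's theorem
   concludes. *)
Require Import Defs.
From Stdlib Require Import Reals Lra Lia Classical.
From Coquelicot Require Import Coquelicot.
Open Scope R_scope.

(** * Moduli, complex series and dominated convergence *)

Lemma Cmod_minus_sym (a b : C) : Cmod (a - b) = Cmod (b - a).
Proof. rewrite <- Cmod_opp; f_equal; ring. Qed.

Lemma Cmod_minus_triangle (a b : C) : Cmod (a - b) <= Cmod a + Cmod b.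
Proof. unfold Cminus; rewrite <- (Cmod_opp b); apply Cmod_triangle. Qed.

Lemma Cmod_minus_triangle_inv (a b : C) : Cmod a - Cmod b <= Cmod (a - b).
Proof.
assert (h := Cmod_triangle (a - b) b).
replace (a - b + b)%C with a in h by ring; lra.
Qed.

Lemma is_lim_seq_Cmod (u : nat -> C) (l : C) :
  filterlim u eventually (locally l) -> is_lim_seq (fun n => Cmod (u n)) (Cmod l).
Proof.
intros h.
apply (filterlim_comp _ _ _ u Cmod _ _ _ h).
apply (@filterlim_norm C_AbsRing C_NormedModule).
Qed.

Lemma is_series_unique_C (a : nat -> C) (s t : C) :
  is_series a s -> is_series a t -> s = t.
Proof. intros hs ht; exact (filterlim_locally_unique (sum_n a) s t hs ht). Qed.

Lemma sum_n_S_C (a : nat -> C) (n : nat) : sum_n a (S n) = (sum_n a n + a (S n))%C.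
Proof. exact (sum_Sn a n). Qed.

Lemma sum_n_S_R (a : nat -> R) (n : nat) : sum_n a (S n) = sum_n a n + a (S n).
Proof. exact (sum_Sn a n). Qed.

(** Each term after the first is the difference of two consecutive partial sums, and both of these
    tend to [s]. *)
Lemma Cmod_series_term_lim_0 (a : nat -> C) (s : C) :
  is_series a s -> is_lim_seq (fun n => Cmod (a n)) 0.
Proof.
intros h.
apply is_lim_seq_incr_1.
assert (h1 : filterlim (fun n => sum_n a (S n)) eventually (locally s)).
{ apply (filterlim_comp _ _ _ S (sum_n a) _ _ _ (eventually_subseq S ltac:(intros; lia)) h). }
assert (h2 := filterlim_comp_2 _ _ _ h1
   (filterlim_comp _ _ _ _ _ _ _ _ h (@filterlim_opp C_AbsRing C_NormedModule s))
   (@filterlim_plus C_AbsRing C_NormedModule s (opp s))).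
apply is_lim_seq_Cmod in h2.
change (is_lim_seq (fun n => Cmod (sum_n a (S n) + - sum_n a n)) (Cmod (s + - s))) in h2.
replace (s + - s)%C with (RtoC 0) in h2 by ring; rewrite Cmod_0 in h2.
revert h2; apply is_lim_seq_ext; intros n.
rewrite sum_n_S_C; f_equal; ring.
Qed.

(** The triangle inequality bounds the finite block of terms from [K + 1] to [K + j]; the tail bound
    follows by letting [j] tend to infinity. *)
Lemma Cmod_series_remainder (w : nat -> C) (b : nat -> R) (l : C) (B : R) (K : nat) :
  (forall k, Cmod (w k) <= b k) -> is_series w l -> is_series b B ->
  Cmod (l - sum_n w K) <= B - sum_n b K.
Proof.
intros hb hw hB.
assert (h : forall j, Cmod (sum_n w (j + K) - sum_n w K) <= sum_n b (j + K) - sum_n b K).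
{ induction j as [|j IH]; simpl.
  - replace (sum_n w K - sum_n w K)%C with (RtoC 0) by ring; rewrite Cmod_0; lra.
  - rewrite sum_n_S_C, sum_n_S_R.
    replace (sum_n w (j + K) + w (S (j + K)) - sum_n w K)%C
      with ((sum_n w (j + K) - sum_n w K) + w (S (j + K)))%C by ring.
    eapply Rle_trans; [apply Cmod_triangle|].
    specialize (hb (S (j + K))); lra. }
assert (h1 : is_lim_seq (fun j => Cmod (sum_n w (j + K) - sum_n w K)) (Cmod (l - sum_n w K))).
{ apply (is_lim_seq_incr_n (fun j => Cmod (sum_n w j - sum_n w K)) K).
  apply is_lim_seq_Cmod.
  apply (filterlim_comp_2 (sum_n w) (fun _ => opp (sum_n w K)) plus hw (filterlim_const _)).
  apply (@filterlim_plus C_AbsRing C_NormedModule). }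
assert (h2 : is_lim_seq (fun j => sum_n b (j + K) - sum_n b K) (B - sum_n b K)).
{ apply (is_lim_seq_incr_n (fun j => sum_n b j - sum_n b K) K).
  apply is_lim_seq_minus'; [exact hB | apply is_lim_seq_const]. }
exact (is_lim_seq_le _ _ _ _ h h1 h2).
Qed.

Lemma tannery (a : nat -> nat -> C) (v S : nat -> C) (e : C) (M : nat -> R) :
  eventually (fun n => forall k, Cmod (a n k) <= M k) -> ex_series M ->
  (forall k, is_lim_seq (fun n => Cmod (a n k - v k)) 0) ->
  (forall n, is_series (a n) (S n)) -> is_series v e ->
  is_lim_seq (fun n => Cmod (S n - e)) 0.
Proof.
intros [N0 hM] [B hB] hlim hS hv.
(* The limit terms inherit the domination, so the tail of [v] is controlled by the same remainder of
   [M] as the tails of [a n]. *)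
assert (hvM : forall k, Cmod (v k) <= M k).
{ intros k.
  apply (is_lim_seq_le_loc (fun _ => Cmod (v k)) (fun n => M k + Cmod (a n k - v k))
           (Cmod (v k)) (M k)).
  - exists N0; intros n hn.
    assert (h := Cmod_minus_triangle_inv (v k) (a n k)).
    rewrite Cmod_minus_sym in h; specialize (hM n hn k); lra.
  - apply is_lim_seq_const.
  - replace (Finite (M k)) with (Finite (M k + 0)) by (f_equal; ring).
    apply is_lim_seq_plus'; [apply is_lim_seq_const | apply hlim]. }
assert (hsum : forall K, is_lim_seq (fun n => Cmod (sum_n (a n) K - sum_n v K)) 0).
{ induction K as [|K IH].
  - apply (is_lim_seq_ext (fun n => Cmod (a n 0%nat - v 0%nat))); [|apply hlim].
    intros n; rewrite !sum_O; reflexivity.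
  - apply is_lim_seq_le_le with
      (u := fun _ => 0)
      (w := fun n => Cmod (sum_n (a n) K - sum_n v K)
                     + Cmod (a n (Datatypes.S K) - v (Datatypes.S K))).
    + intros n; split; [apply Cmod_ge_0|].
      rewrite !sum_n_S_C.
      eapply Rle_trans; [|apply Cmod_triangle]; right; f_equal; ring.
    + apply is_lim_seq_const.
    + replace (Finite 0) with (Finite (0 + 0)) by (f_equal; ring).
      apply is_lim_seq_plus'; [exact IH | apply hlim]. }
apply is_lim_seq_spec; intros eps.
assert (hB' : is_lim_seq (sum_n M) B) by exact hB.
apply is_lim_seq_spec in hB'.
(* One third each for the tail of [a n], the tail of [v], and the difference of their partial sums
   up to [K]. The cut [K] depends on [M] only, hence is chosen before [n]. *)
assert (h3 : 0 < eps / 3) by (destruct eps as [x hx]; simpl; lra).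
destruct (hB' (mkposreal _ h3)) as [K hK]; specialize (hK K (le_n K)); simpl in hK.
assert (hs := hsum K); apply is_lim_seq_spec in hs.
destruct (hs (mkposreal _ h3)) as [N1 hN1]; simpl in hN1.
exists (max N0 N1); intros n hn.
specialize (hN1 n ltac:(lia)); specialize (hM n ltac:(lia)).
rewrite Rminus_0_r, Rabs_pos_eq in hN1 by apply Cmod_ge_0.
rewrite Rminus_0_r, Rabs_pos_eq by apply Cmod_ge_0.
apply Rabs_lt_between in hK.
assert (r1 := Cmod_series_remainder _ _ _ _ K hM (hS n) hB).
assert (r2 := Cmod_series_remainder _ _ _ _ K hvM hv hB).
replace (S n - e)%C with
  ((S n - sum_n (a n) K) + ((sum_n (a n) K - sum_n v K) - (e - sum_n v K)))%C by ring.
assert (t1 := Cmod_triangle (S n - sum_n (a n) K)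
                ((sum_n (a n) K - sum_n v K) - (e - sum_n v K))).
assert (t2 := Cmod_minus_triangle (sum_n (a n) K - sum_n v K) (e - sum_n v K)).
lra.
Qed.

(** * Elementary inequalities *)

(** Taking inverses, 1/(1-x) = 1 + x/(1-x) <= 1 + x/(1-r) <= exp(x/(1-r)). This turns products of
    factors 1 - r^j into sums in an exponent. *)
Lemma exp_le_inv_one_minus (x r : R) : 0 <= x <= r -> r < 1 -> exp (- (x / (1 - r))) <= 1 - x.
Proof.
intros hx hr.
rewrite exp_Ropp.
rewrite <- (Rinv_inv (1 - x)).
apply Rinv_le_contravar; [apply Rinv_0_lt_compat; lra|].
eapply Rle_trans; [|apply exp_ineq1_le].
apply Rle_trans with (1 + x / (1 - x)); [right; field; lra|].
apply Rplus_le_compat_l, Rmult_le_compat_l; [lra|].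
apply Rinv_le_contravar; lra.
Qed.

Lemma exp_le (x y : R) : x <= y -> exp x <= exp y.
Proof.
intros [h| ->]; [left; now apply exp_increasing | right; reflexivity].
Qed.

Lemma Cone_minus_neq_0 (z : C) : Cmod z < 1 -> (1 - z)%C <> 0%C.
Proof.
intros h k.
assert (z = RtoC 1) by (replace z with (1 - (1 - z))%C by ring; rewrite k; ring).
subst z; rewrite Cmod_1 in h; lra.
Qed.

(** * Bounds for q-factorials and falling products when |q| < 1 *)

Section InsideDisk.

Variable q : C.
Hypothesis hq : Cmod q < 1.

Let r := Cmod q.
Let d := Cmod (1 - q).

Lemma r_ge_0 : 0 <= r.
Proof. apply Cmod_ge_0. Qed.

Lemma d_gt_0 : 0 < d.
Proof. now apply Cmod_gt_0, Cone_minus_neq_0. Qed.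

Lemma r_pow_S_le (n : nat) : 0 <= r ^ S n <= r.
Proof.
assert (h := r_ge_0).
split; [now apply pow_le|].
assert (h1 : r ^ n <= 1 ^ n) by (apply pow_incr; unfold r in *; lra).
rewrite pow1 in h1; simpl; nra.
Qed.

Lemma qnum_INR (n : nat) : qnum q (INR n) = ((1 - q ^ n) / (1 - q))%C.
Proof. unfold qnum; now rewrite qpow_INR. Qed.

Lemma Cmod_one_minus_pow (n : nat) : 1 - r ^ n <= Cmod (1 - q ^ n) <= 1 + r ^ n.
Proof.
assert (h1 := Cmod_minus_triangle 1 (q ^ n)).
assert (h2 := Cmod_minus_triangle_inv 1 (q ^ n)).
rewrite Cmod_1, Cmod_pow in h1, h2; unfold r; lra.
Qed.

Lemma Cmod_qnum_INR (n : nat) : 1 - r ^ n <= d * Cmod (qnum q (INR n)) <= 1 + r ^ n.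
Proof.
rewrite qnum_INR, Cmod_div by now apply Cone_minus_neq_0.
fold d; replace (d * (Cmod (1 - q ^ n) / d)) with (Cmod (1 - q ^ n)).
- apply Cmod_one_minus_pow.
- field; apply Rgt_not_eq, d_gt_0.
Qed.

Lemma qnum_S_neq_0 (n : nat) : qnum q (INR (S n)) <> 0%C.
Proof.
apply Cmod_gt_0.
assert (h := Cmod_qnum_INR (S n)); assert (h1 := r_pow_S_le n); assert (h2 := d_gt_0).
unfold r in *; nra.
Qed.

Lemma qfact_neq_0 (k : nat) : qfact q k <> 0%C.
Proof.
induction k as [|k IH]; [exact C1_nz|].
apply Cmult_neq_0; [apply qnum_S_neq_0 | exact IH].
Qed.

(* The exponent is the geometric sum of r^j / (1 - r) over 1 <= j <= k. *)
Lemma qfact_lower (k : nat) :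
  exp (- ((r - r ^ S k) / (1 - r) ^ 2)) <= d ^ k * Cmod (qfact q k).
Proof.
assert (hd := d_gt_0); assert (hr : r < 1) by exact hq.
induction k as [|k IH].
- simpl; rewrite Cmod_1.
  replace (- _) with 0 by (field; lra); rewrite exp_0; lra.
- change (qfact q (S k)) with (qnum q (INR (S k)) * qfact q k)%C; rewrite Cmod_mult.
  replace (d ^ S k * _) with
    ((d ^ k * Cmod (qfact q k)) * (d * Cmod (qnum q (INR (S k))))) by (simpl; ring).
  replace (- _) with
    (- ((r - r ^ S k) / (1 - r) ^ 2) + - (r ^ S k / (1 - r))) by (simpl; field; lra).
  rewrite exp_plus.
  apply Rmult_le_compat; try (left; apply exp_pos); [exact IH|].
  eapply Rle_trans; [apply exp_le_inv_one_minus|]; [apply r_pow_S_le | exact hr |].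
  apply Cmod_qnum_INR.
Qed.

(** Each factor is at most 1 + r^j <= exp(r^j), and the exponents add up to the geometric sum over 1
    <= j <= k. *)
Lemma qfact_upper (k : nat) :
  d ^ k * Cmod (qfact q k) <= exp ((r - r ^ S k) / (1 - r)).
Proof.
assert (hd := d_gt_0); assert (hr : r < 1) by exact hq.
induction k as [|k IH].
- simpl; rewrite Cmod_1.
  replace (_ / _) with 0 by (field; lra); rewrite exp_0; lra.
- change (qfact q (S k)) with (qnum q (INR (S k)) * qfact q k)%C; rewrite Cmod_mult.
  replace (d ^ S k * _) with
    ((d ^ k * Cmod (qfact q k)) * (d * Cmod (qnum q (INR (S k))))) by (simpl; ring).
  replace ((r - r ^ S (S k)) / _) with
    ((r - r ^ S k) / (1 - r) + r ^ S k) by (simpl; field; lra).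
  rewrite exp_plus.
  apply Rmult_le_compat; [| |exact IH|].
  + apply Rmult_le_pos; [apply pow_le; lra | apply Cmod_ge_0].
  + apply Rmult_le_pos; [lra | apply Cmod_ge_0].
  + eapply Rle_trans; [apply Cmod_qnum_INR | apply exp_ineq1_le].
Qed.

(* The factors are [m+1]_q, ..., [m+k]_q; the exponent is the sum of r^j over all
   j > m, which makes the induction on k close. *)
Lemma qfalling_upper (k m : nat) :
  d ^ k * Cmod (qfalling q (INR (k + m)) k) <= exp (r ^ S m / (1 - r)).
Proof.
assert (hd := d_gt_0); assert (hr : r < 1) by exact hq.
revert m; induction k as [|k IH]; intros m.
- simpl; rewrite Cmod_1.
  assert (h0 : 0 <= r ^ S m / (1 - r)).
  { apply Rdiv_le_0_compat; [apply r_pow_S_le | lra]. }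
  assert (h1 := exp_ineq1_le (r ^ S m / (1 - r))); simpl in *; lra.
(* Moving one unit from [k] to [m] keeps the argument fixed: the factor split off is [m+1]_q, and
   the induction hypothesis applies at [S m]. *)
- replace (S k + m)%nat with (k + S m)%nat by lia.
  set (x := INR (k + S m)); simpl qfalling; rewrite Cmod_mult; unfold x.
  replace (INR (k + S m) - INR k) with (INR (S m)) by (rewrite plus_INR; ring).
  replace (d ^ S k * _) with
    ((d ^ k * Cmod (qfalling q (INR (k + S m)) k)) * (d * Cmod (qnum q (INR (S m)))))
    by (simpl; ring).
  replace (r ^ S m / (1 - r)) with (r ^ S (S m) / (1 - r) + r ^ S m) by (simpl; field; lra).
  rewrite exp_plus.
  apply Rmult_le_compat; [| |apply IH|].
  + apply Rmult_le_pos; [apply pow_le; lra | apply Cmod_ge_0].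
  + apply Rmult_le_pos; [lra | apply Cmod_ge_0].
  + eapply Rle_trans; [apply Cmod_qnum_INR | apply exp_ineq1_le].
Qed.

(** The product contains the factor [n-n]_q = [0]_q = 0. *)
Lemma qfalling_eq_0 (n k : nat) : (n < k)%nat -> qfalling q (INR n) k = 0%C.
Proof.
induction k as [|k IH]; intros h; [lia|].
simpl; destruct (Nat.eq_dec n k) as [->|hne].
- replace (INR k - INR k) with (INR 0) by (simpl; ring); rewrite qnum_INR.
  change (q ^ 0)%C with (RtoC 1); unfold Cdiv; ring.
- rewrite IH by lia; ring.
Qed.

Lemma e_const_imp_disk (e : C) : is_e_const q e -> d < 1.
Proof.
intros he.
destruct (Rlt_le_dec d 1) as [h|h]; [exact h|exfalso].
assert (hr : r < 1) by exact hq.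
apply Cmod_series_term_lim_0 in he.
(* By [qfact_upper] and r - r^(k+1) <= r, the product [d ^ k * Cmod (qfact q k)] is at most 1/c. If
   [d >= 1], every term of the series has modulus at least [c], so the terms cannot tend to 0. *)
set (c := exp (- (r / (1 - r)))).
assert (hc : 0 < c) by apply exp_pos.
assert (hle : c <= 0); [|lra].
apply (is_lim_seq_le (fun _ => c) (fun k => Cmod (1 / qfact q k)) c 0); [|apply is_lim_seq_const|exact he].
intros k; simpl.
assert (hf := qfact_neq_0 k).
rewrite Cmod_div, Cmod_1 by exact hf.
apply Cmod_gt_0 in hf.
unfold c; rewrite exp_Ropp; unfold Rdiv at 2; rewrite Rmult_1_l.
apply Rinv_le_contravar; [exact hf|].
apply Rle_trans with (d ^ k * Cmod (qfact q k)).
- assert (h1 := pow_R1_Rle d k h); nra.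
- eapply Rle_trans; [apply qfact_upper | apply exp_le].
  destruct (r_pow_S_le k) as [h1 _].
  apply Rmult_le_compat_r; [left; apply Rinv_0_lt_compat; lra | lra].
Qed.

Lemma qadd1_pow_INR (b : C) (n : nat) :
  is_qadd1_pow q b (INR n) (sum_n (fun k => (qbinom q (INR n) k * b ^ k)%C) n).
Proof.
set (f := fun k => (qbinom q (INR n) k * b ^ k)%C).
assert (h : forall m, (n <= m)%nat -> sum_n f n = sum_n f m).
{ intros m hm; induction hm as [|m hm IH]; [reflexivity|].
  rewrite sum_n_S_C, <- IH.
  replace (f (S m)) with (RtoC 0); [symmetry; apply Cplus_0_r|].
  unfold f, qbinom; rewrite qfalling_eq_0 by lia; unfold Cdiv; ring. }
apply filterlim_ext_loc with (f := fun _ : nat => sum_n f n); [|apply filterlim_const].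
now exists n.
Qed.

(** * Termwise limits and domination along the integers *)

Lemma is_lim_seq_r_pow : is_lim_seq (fun n => r ^ n) 0.
Proof. apply is_lim_seq_geom; rewrite Rabs_pos_eq by apply r_ge_0; exact hq. Qed.

Lemma qnum_ratio_lim (j : nat) :
  is_lim_seq (fun n => Cmod (qnum q (INR n - INR j) * (1 / qnum q (INR n)) - 1)) 0.
Proof.
assert (hr : r < 1) by exact hq.
assert (hr0 := r_ge_0).
(* After this shift the two q-numbers have positive integer arguments, so the denominator does not
   vanish. The difference becomes (q^(n+j+1) - q^(n+1)) / (1 - q^(n+j+1)), with numerator at most 2
   r^(n+1) and denominator at least 1 - r in modulus. *)
apply is_lim_seq_incr_n with (N := S j).
apply is_lim_seq_le_le with (u := fun _ => 0) (w := fun n => 2 / (1 - r) * r ^ S n).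
- intros n; split; [apply Cmod_ge_0|].
  replace (n + S j)%nat with (S (n + j)) by lia.
  replace (INR (S (n + j)) - INR j) with (INR (S n)) by (rewrite !S_INR, plus_INR; ring).
  rewrite !qnum_INR.
  assert (hc := Cmod_one_minus_pow (S (n + j))).
  assert (hp := r_pow_S_le (n + j)).
  assert (h1 : (1 - q ^ S (n + j))%C <> 0%C) by (apply Cmod_gt_0; lra).
  assert (h2 := Cone_minus_neq_0 _ hq).
  replace (_ - _)%C with
    ((q ^ S (n + j) - q ^ S n) / (1 - q ^ S (n + j)))%C by (field; split; assumption).
  rewrite Cmod_div by exact h1.
  replace (2 / (1 - r) * r ^ S n) with ((2 * r ^ S n) * / (1 - r)) by (field; lra).
  apply Rmult_le_compat.
  + apply Cmod_ge_0.
  + left; apply Rinv_0_lt_compat; lra.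
  + eapply Rle_trans; [apply Cmod_minus_triangle|].
    rewrite !Cmod_pow; fold r.
    replace (S (n + j)) with (S n + j)%nat by lia; rewrite pow_add.
    assert (h3 : r ^ j <= 1 ^ j) by (apply pow_incr; lra).
    rewrite pow1 in h3; assert (h4 := r_pow_S_le n); nra.
  + apply Rinv_le_contravar; lra.
- apply is_lim_seq_const.
- replace (Finite 0) with (Rbar_mult (2 / (1 - r)) 0) by (simpl; f_equal; ring).
  apply is_lim_seq_scal_l, (is_lim_seq_incr_1 (fun n => r ^ n)), is_lim_seq_r_pow.
Qed.

Lemma qfalling_ratio_lim (k : nat) :
  is_lim_seq (fun n => Cmod (qfalling q (INR n) k * (1 / qnum q (INR n)) ^ k - 1)) 0.
Proof.
induction k as [|k IH].
- apply is_lim_seq_ext with (u := fun _ => 0); [|apply is_lim_seq_const].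
  intros n; simpl; replace (1 * 1 - 1)%C with (RtoC 0) by ring; now rewrite Cmod_0.
- assert (hg := qnum_ratio_lim k).
  set (u := fun n => Cmod (qfalling q (INR n) k * (1 / qnum q (INR n)) ^ k - 1)) in *.
  set (g := fun n => Cmod (qnum q (INR n - INR k) * (1 / qnum q (INR n)) - 1)) in *.
  (* From (1+U)(1+G) - 1 = UG + U + G, where [U] and [G] are the deviations from 1 of the first [k]
     factors and of the new one. *)
  apply is_lim_seq_le_le with (u := fun _ => 0) (w := fun n => u n * g n + u n + g n).
  + intros n; split; [apply Cmod_ge_0|].
    unfold u, g; rewrite <- Cmod_mult.
    eapply Rle_trans; [|apply Rplus_le_compat_r, Cmod_triangle].
    eapply Rle_trans; [|apply Cmod_triangle].
    rewrite Cpow_S; simpl qfalling; right; f_equal; ring.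
  + apply is_lim_seq_const.
  + replace (Finite 0) with (Finite (0 * 0 + 0 + 0)) by (f_equal; ring).
    apply is_lim_seq_plus'; [apply is_lim_seq_plus'|]; try assumption.
    now apply is_lim_seq_mult'.
Qed.

Lemma qadd1_pow_term_lim (k : nat) :
  is_lim_seq (fun n => Cmod (qbinom q (INR n) k * (1 / qnum q (INR n)) ^ k
                             - 1 / qfact q k)) 0.
Proof.
assert (hf := qfact_neq_0 k).
apply is_lim_seq_ext with
  (u := fun n => / Cmod (qfact q k) *
         Cmod (qfalling q (INR n) k * (1 / qnum q (INR n)) ^ k - 1)).
- intros n; rewrite <- Cmod_inv by exact hf; rewrite <- Cmod_mult.
  unfold qbinom, Cdiv; f_equal; ring.
- replace (Finite 0) with (Rbar_mult (/ Cmod (qfact q k)) 0) by (simpl; f_equal; ring).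
  apply is_lim_seq_scal_l, qfalling_ratio_lim.
Qed.

(** In the q-binomial the powers [d ^ k] of numerator and denominator cancel, leaving the two
    exponential constants. The hypothesis on [rho] gives 1/|[n]_q| <= rho, because d |[n]_q| >= 1 -
    r^n. The bound is uniform in [n], as Tannery's theorem requires. *)
Lemma qadd1_pow_term_bound (n k : nat) (rho : R) : d <= rho * (1 - r ^ n) -> (0 < n)%nat ->
  Cmod (qbinom q (INR n) k * (1 / qnum q (INR n)) ^ k)
  <= exp (1 / (1 - r)) * exp (1 / (1 - r) ^ 2) * rho ^ k.
Proof.
intros hrho hn.
assert (hd := d_gt_0); assert (hr : r < 1) by exact hq; assert (hr0 := r_ge_0).
assert (hrn : r ^ n < 1).
{ destruct n as [|n]; [lia|]; destruct (r_pow_S_le n); lra. }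
assert (hrho0 : 0 < rho) by nra.
set (A := exp (1 / (1 - r))); set (B := exp (1 / (1 - r) ^ 2)).
assert (hA : 0 < A) by apply exp_pos; assert (hB : 0 < B) by apply exp_pos.
assert (hk0 : 0 < rho ^ k) by now apply pow_lt.
destruct (Nat.le_gt_cases k n) as [hk|hk].
2:{ unfold qbinom; rewrite qfalling_eq_0 by exact hk.
    replace (_ * _)%C with (RtoC 0) by (unfold Cdiv; ring).
    rewrite Cmod_0; left; repeat apply Rmult_lt_0_compat; assumption. }
assert (hf := qfact_neq_0 k).
assert (hF : d ^ k * Cmod (qfalling q (INR n) k) <= A).
{ replace n with (k + (n - k))%nat by lia.
  eapply Rle_trans; [apply qfalling_upper|].
  apply exp_le, Rmult_le_compat_r; [left; apply Rinv_0_lt_compat; lra|].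
  destruct (r_pow_S_le (n - k)); lra. }
assert (hQ : 1 <= B * (d ^ k * Cmod (qfact q k))).
{ apply Rle_trans with (B * exp (- ((r - r ^ S k) / (1 - r) ^ 2))).
  - unfold B; rewrite <- exp_plus; rewrite <- exp_0 at 1; apply exp_le.
    destruct (r_pow_S_le k) as [h1 _].
    assert (h2 : (r - r ^ S k) / (1 - r) ^ 2 <= 1 / (1 - r) ^ 2); [|lra].
    apply Rmult_le_compat_r; [left; apply Rinv_0_lt_compat, pow_lt|]; lra.
  - apply Rmult_le_compat_l; [lra | apply qfact_lower]. }
assert (hN : 1 <= rho * Cmod (qnum q (INR n))).
{ destruct (Cmod_qnum_INR n) as [h1 _].
  apply Rmult_le_reg_l with d; [exact hd|]; nra. }
assert (hn0 : 0 < Cmod (qnum q (INR n))) by (assert (h := Cmod_ge_0 (qnum q (INR n))); nra).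
assert (hn1 : qnum q (INR n) <> 0%C) by now apply Cmod_gt_0.
assert (hdk : 0 < d ^ k) by now apply pow_lt.
assert (hq0 : 0 < Cmod (qfact q k)) by now apply Cmod_gt_0.
unfold qbinom; rewrite Cmod_mult, Cmod_pow, !Cmod_div, Cmod_1 by assumption.
apply Rmult_le_compat.
- apply Rdiv_le_0_compat; [apply Cmod_ge_0 | exact hq0].
- apply pow_le, Rdiv_le_0_compat; [lra | exact hn0].
- apply Rle_div_l; [exact hq0|].
  apply Rmult_le_reg_l with (d ^ k); [exact hdk|]; nra.
- apply pow_incr; split; [apply Rdiv_le_0_compat; [lra | exact hn0]|].
  apply Rle_div_l; assumption.
Qed.

Lemma qadd1_pow_lim (e : C) (S : nat -> C) : is_e_const q e ->
  (forall n, is_qadd1_pow q (1 / qnum q (INR n)) (INR n) (S n)) ->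
  is_lim_seq (fun n => Cmod (S n - e)) 0.
Proof.
intros he hS.
assert (hd1 := e_const_imp_disk e he); assert (hd := d_gt_0).
(* The midpoint of [d] and 1: [rho < 1] makes the dominating series geometric and convergent, while
   [d / rho < 1] leaves room for r^n < 1 - d/rho at large [n]. *)
set (rho := (1 + d) / 2).
apply tannery with
  (a := fun n k => (qbinom q (INR n) k * (1 / qnum q (INR n)) ^ k)%C)
  (v := fun k => (1 / qfact q k)%C)
  (M := fun k => exp (1 / (1 - r)) * exp (1 / (1 - r) ^ 2) * rho ^ k).
- assert (hl := is_lim_seq_r_pow); apply is_lim_seq_spec in hl.
  assert (hp : 0 < 1 - d / rho).
  { apply Rlt_0_minus, Rlt_div_l; unfold rho; lra. }
  destruct (hl (mkposreal _ hp)) as [N hN]; simpl in hN.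
  exists (Nat.max N 1); intros n hn k.
  apply qadd1_pow_term_bound; [|lia].
  specialize (hN n ltac:(lia)).
  rewrite Rminus_0_r in hN; apply Rabs_lt_between in hN.
  assert (h : d = rho * (d / rho)) by (field; unfold rho; lra).
  rewrite h at 1; apply Rmult_le_compat_l; unfold rho in *; lra.
- apply (ex_series_scal_l (K := R_AbsRing) (V := R_NormedModule)), ex_series_geom.
  rewrite Rabs_pos_eq; unfold rho; lra.
- exact qadd1_pow_term_lim.
- exact hS.
- exact he.
Qed.

(** * Divergence at exponents that are not natural numbers *)

Lemma Cmod_qpow (x : R) : q <> 0%C -> Cmod (qpow q x) = Rpower r x.
Proof.
intros h; apply Cmod_gt_0 in h.
unfold qpow; destruct (Req_EM_T (Cmod q) 0) as [k|_]; [lra|].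
rewrite Cmod_mult, Cmod_R, Rabs_pos_eq by (left; apply exp_pos); fold r.
replace (Cmod _) with 1; [ring|].
unfold Cmod; simpl; rewrite !Rmult_1_r.
assert (e := sin2_cos2 (x * Carg q)); unfold Rsqr in e.
rewrite Rplus_comm, e; symmetry; apply sqrt_1.
Qed.

(** A zero would force q^x = 1, hence r^x = 1 on taking moduli, which is impossible since ln r <
    0. *)
Lemma qnum_neq_0 (x : R) : q <> 0%C -> x <> 0 -> qnum q x <> 0%C.
Proof.
intros h hx k.
assert (h1 : qpow q x = RtoC 1).
{ assert (h2 := Cone_minus_neq_0 _ hq).
  replace (qpow q x) with (1 - qnum q x * (1 - q))%C by (unfold qnum; field; exact h2).
  rewrite k; ring. }
assert (h3 := Cmod_qpow x h); rewrite h1, Cmod_1 in h3.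
apply Cmod_gt_0 in h; fold r in h.
assert (hl : ln r < 0) by (rewrite <- ln_1; apply ln_increasing; assumption).
unfold Rpower in h3; rewrite <- exp_0 in h3; apply exp_inv in h3; nra.
Qed.

(** No factor [x-k]_q vanishes, so all terms are nonzero; their moduli are eventually nondecreasing
    and cannot tend to 0. *)
Lemma qadd1_pow_diverges (x : R) (s : C) : q <> 0%C ->
  (forall n, x <> INR n) -> ~ is_qadd1_pow q (1 / qnum q x) x s.
Proof.
intros hq0 hx hs.
assert (hd := d_gt_0); assert (hr : r < 1) by exact hq.
assert (hr0 : 0 < r) by now apply Cmod_gt_0.
assert (hx0 : qnum q x <> 0%C) by (apply qnum_neq_0; [exact hq0 | exact (hx 0%nat)]).
apply Cmod_series_term_lim_0 in hs.
set (a := fun k => Cmod (qbinom q x k * (1 / qnum q x) ^ k)) in hs.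
set (X := Cmod (qnum q x)).
assert (hX : 0 < X) by now apply Cmod_gt_0.
assert (hstep : forall k, a (S k) =
  a k * (Cmod (qnum q (x - INR k)) / (Cmod (qnum q (INR (S k))) * X))).
{ intros k; unfold a, X, qbinom.
  assert (h1 := qfact_neq_0 k); assert (h2 := qnum_S_neq_0 k).
  rewrite <- Cmod_mult, <- Cmod_div by now apply Cmult_neq_0.
  rewrite <- Cmod_mult, Cpow_S; f_equal.
  simpl qfalling; change (qfact q (S k)) with (qnum q (INR (S k)) * qfact q k)%C.
  set (y := INR (S k)) in *; clearbody y.
  field; repeat split; assumption. }
assert (hpos : forall k, 0 < a k).
{ induction k as [|k IH].
  - unfold a, qbinom; simpl.
    replace (_ * _)%C with (RtoC 1) by field; rewrite Cmod_1; lra.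
  - rewrite hstep; apply Rmult_lt_0_compat; [exact IH|].
    apply Rdiv_lt_0_compat; [|apply Rmult_lt_0_compat; [|exact hX]]; apply Cmod_gt_0.
    + apply qnum_neq_0; [exact hq0|]; specialize (hx k); lra.
    + apply qnum_S_neq_0. }
assert (hgrow : exists N, forall k, (N <= k)%nat -> a k <= a (S k)).
{ assert (hl := is_lim_seq_r_pow); apply is_lim_seq_spec in hl.
  (* The ratio is at least 1 once d |[x-k]_q| >= d |[k+1]_q| X. The left side is at least r^(x-k) -
     1 and the right side at most 2X, so r^k < r^x / (1 + 2X) suffices. *)
  assert (hp : 0 < Rpower r x / (1 + 2 * X)) by (apply Rdiv_lt_0_compat; [apply exp_pos | lra]).
  destruct (hl (mkposreal _ hp)) as [N hN]; simpl in hN.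
  exists N; intros k hk; specialize (hN k hk).
  assert (hk0 : 0 < r ^ k) by now apply pow_lt.
  rewrite Rminus_0_r, Rabs_pos_eq in hN by lra.
  apply Rlt_div_r in hN; [|lra].
  rewrite hstep; rewrite <- (Rmult_1_r (a k)) at 1.
  apply Rmult_le_compat_l; [left; apply hpos|].
  assert (h1 : 0 < Cmod (qnum q (INR (S k)))) by apply Cmod_gt_0, qnum_S_neq_0.
  apply Rle_div_r; [now apply Rmult_lt_0_compat|].
  rewrite Rmult_1_l.
  apply Rmult_le_reg_l with d; [exact hd|].
  apply Rle_trans with (2 * X).
  - destruct (Cmod_qnum_INR (S k)) as [_ h2]; destruct (r_pow_S_le k) as [_ h3]; nra.
  - unfold qnum; rewrite Cmod_div by now apply Cone_minus_neq_0.
    fold d; replace (d * (_ / d)) with (Cmod (1 - qpow q (x - INR k))) by (field; lra).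
    rewrite Cmod_minus_sym.
    eapply Rle_trans; [|apply Cmod_minus_triangle_inv].
    rewrite Cmod_1, Cmod_qpow by exact hq0.
    unfold Rminus at 2; rewrite Rpower_plus, Rpower_Ropp, Rpower_pow by exact hr0.
    assert (h2 : 1 + 2 * X <= Rpower r x * / r ^ k); [|lra].
    apply Rle_div_r; [exact hk0 | lra]. }
destruct hgrow as [N hN].
assert (hge : a N <= 0).
{ apply (is_lim_seq_le_loc (fun _ => a N) a (a N) 0);
    [|apply is_lim_seq_const | exact hs].
  exists N; intros k hk; induction hk as [|k hk IH]; [lra|].
  specialize (hN k hk); lra. }
specialize (hpos N); lra.
Qed.

End InsideDisk.

Theorem proposition2 (q : C) (hq : Cmod q < 1) (e : C) (he : is_e_const q e) :
  is_partial_lim_pinfty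
    (fun (x : R) (s : C) => is_qadd1_pow q (1 / qnum q x)%C x s) e.
Proof.
assert (hq0 : q <> 0%C).
(* For q = 0 one would have |1 - q| = 1, against [e_const_imp_disk]. *)
{ intros h; apply e_const_imp_disk in he; [|exact hq].
  rewrite h in he; replace (1 - 0)%C with (RtoC 1) in he by ring.
  rewrite Cmod_1 in he; lra. }
split.
- intros M; destruct (INR_unbounded M) as [n hn].
  eexists (INR n), _; split; [exact hn | apply qadd1_pow_INR].
- assert (hS := fun n => qadd1_pow_INR q (1 / qnum q (INR n)) n).
  assert (hl := qadd1_pow_lim q hq e _ he hS).
  apply is_lim_seq_spec in hl.
  intros P [eps hP].
  destruct (hl eps) as [N hN].
  exists (INR N); intros x hx [s hs].
  exists s; split; [exact hs|].
  (* A point of the domain must be a natural number by divergence elsewhere; there, uniqueness of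
     sums identifies [s] with the finite sum. *)
  destruct (classic (exists n, x = INR n)) as [[n ->]|hno].
  2:{ destruct (qadd1_pow_diverges q hq x s hq0); [|exact hs].
      intros n hn; apply hno; now exists n. }
  rewrite (is_series_unique_C _ _ _ hs (hS n)).
  (* Balls of [C] are coordinatewise, so a bound on the modulus of the difference is enough. *)
  apply hP, C_NormedModule_mixin_compat1.
  apply INR_lt in hx; specialize (hN n ltac:(lia)).
  rewrite Rminus_0_r, Rabs_pos_eq in hN by apply Cmod_ge_0.
  exact hN.
Qed.
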